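(* Let $G$ be a graph of order $n$ with $\delta(G)=1$. Then $IC(G)=n$ if and only if either $G\simeq K_2$, or $G\in\mathcal{F}$.
   Context: Graphs are finite and simple. $\delta(G)$ is the minimum degree of $G$; $K_2$ is the complete graph of order 2. A pendant vertex is a vertex of degree 1, and its unique neighbor is its support vertex. For a graph $G$ of order $n\ge 3$ with $\delta(G)=1$, a pendant vertex $x$ of $G$ and its support vertex $y$, one has $G\in\mathcal{F}$ if and only if $V(G)\setminus\{x,y\}$ induces a clique (complete subgraph) in $G$; membership in $\mathcal{F}$ may be read as the existence of such a pendant vertex $x$. A set $S$ of vertices is dominating if every vertex is in $S$ or adjacent to a vertex of $S$; it is independent if its vertices are pairwise nonadjacent; an independent dominating set is a set that is both independent and dominating. An independent coalition in $G$ consists of two disjoint independent sets of vertices $V_1,V_2$, neither of which is an independent dominating set but whose union $V_1\cup V_2$ is an independent dominating set; one says that $V_1$ and $V_2$ form an independent coalition. An $ic$-partition of $G$ is a partition $\pi=\{V_1,\dots,V_k\}$ of $V(G)$ into nonempty sets such that every $V_i\in\pi$ either is a singleton dominating set (a dominating set of cardinality 1), or is not an independent dominating set but forms an independent coalition with another set $V_j\in\pi$. The independent coalition number $IC(G)$ is the maximum number of classes of an $ic$-partition of $G$; the assertion $IC(G)=t$ includes that $G$ has an $ic$-partition. *)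

(* Defs.v *)
From mathcomp Require Import all_boot.

Set Implicit Arguments.
Unset Strict Implicit.
Unset Printing Implicit Defensive.

Record sgraph := SGraph {
  vertex :> finType;
  adj : rel vertex;
  adj_sym : symmetric adj;
  adj_irrefl : irreflexive adj
}.

Arguments adj {s} x y.

Definition isomorphic (G H : sgraph) : Prop :=
  exists2 f : G -> H, bijective f & forall x y : G, adj (f x) (f y) = adj x y.

Section Complete.

Variable n : nat.

Definition complete_adj : rel 'I_n := fun i j => i != j.

Fact complete_adj_sym : symmetric complete_adj.
Proof. by move=> i j; rewrite /complete_adj eq_sym. Qed.

Fact complete_adj_irrefl : irreflexive complete_adj.
Proof. by move=> i; rewrite /complete_adj eqxx. Qed.

Definition complete_graph : sgraph :=
  SGraph complete_adj_sym complete_adj_irrefl.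

End Complete.

Notation "''K_' n" := (complete_graph n)
  (at level 8, n at level 2, format "''K_' n").

Section GraphNotions.

Variable G : sgraph.

Implicit Types (x y : G) (A B : {set G}) (pi : {set {set G}}).

Definition order_of : nat := #|vertex G|.

Definition degree x : nat := #|[set y : G | adj x y]|.

(* Every degree is smaller than the order, so the initial value of the
   iterated minimum plays no role when G has a vertex. *)
Definition min_degree : nat := \big[minn/order_of]_(x : G) degree x.

Definition pendant x : bool := degree x == 1.

Definition support_of x y : bool := pendant x && adj x y.

Definition clique A : bool :=
  [forall x in A, forall y in A, (x != y) ==> adj x y].

Definition in_F : bool :=
  [&& 3 <= order_of, min_degree == 1 &
      [exists x : G, exists y : G,
         support_of x y && clique ([set: G] :\: [set x; y])]].

Definition dominating A : bool :=
  [forall x : G, (x \in A) || [exists y in A, adj x y]].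

Definition independent A : bool :=
  [forall x in A, forall y in A, ~~ adj x y].

Definition independent_dominating A : bool := independent A && dominating A.

Definition independent_coalition A B : bool :=
  [&& [disjoint A & B], independent A, independent B,
      ~~ independent_dominating A, ~~ independent_dominating B
    & independent_dominating (A :|: B)].

Definition ic_partition pi : bool :=
  partition pi [set: G] &&
  [forall A in pi,
     ((#|A| == 1) && dominating A) ||
     (~~ independent_dominating A &&
      [exists B in pi, (B != A) && independent_coalition A B])].

Definition IC : nat := \max_(pi : {set {set G}} | ic_partition pi) #|pi|.

(* IC is 0 by convention on graphs without ic-partition, hence the first
   conjunct. *)
Definition IC_is (t : nat) : Prop :=
  (exists pi, ic_partition pi) /\ IC = t.

End GraphNotions.

(* Main.v *)
Require Import Defs.
From mathcomp Require Import all_boot.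

Set Implicit Arguments.
Unset Strict Implicit.
Unset Printing Implicit Defensive.

(** A partition of the vertex set into [order_of G] nonempty classes can only
    be the partition into singletons, so [IC_is G (order_of G)] says that the
    singletons form an ic-partition ([IC_is_order]).  Singletons are
    independent, and that condition becomes one on vertices: every vertex [v]
    is universal or has a partner, that is, another vertex [u] not adjacent to
    [v] such that [v] and [u] together dominate [G]
    ([ic_partition_singletonsP]).

    Now let [x] be a pendant vertex with support [y]; one exists because the
    minimum degree is 1.  The closed neighborhood of [x] is [x], [y], so every
    dominating set meets it.  A vertex [u] outside [x], [y] is therefore not
    universal, and its partner is [x] or [y].  A vertex whose partner is [x]
    is adjacent to every other vertex outside [x], [y]; a vertex whose partner
    is [y] is not adjacent to [y], while its other nonneighbors are.  Two
    distinct nonadjacent vertices outside [x], [y] would both be of the second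
    kind, which is contradictory; so these vertices form a clique
    ([clique_of_ic_singletons]).  Conversely, in such a clique every vertex is
    a partner of [x], and [y] is either universal or has as partner any other
    vertex to which it is not adjacent ([ic_singletons_of_clique]).  In order 2
    there is no vertex outside [x], [y], and the graph is [K_2], where both
    vertices are universal. *)

(** * Partitions into singletons *)

Section SingletonPartition.

Variable T : finType.
Implicit Type pi : {set {set T}}.

Definition singletons : {set {set T}} := [set [set v] | v : T].

Lemma set1_singletons (v : T) : [set v] \in singletons.
Proof. exact: imset_f. Qed.

Lemma card_singletons : #|singletons| = #|T|.
Proof. by rewrite card_imset //; apply: set1_inj. Qed.

Lemma partition_singletons : partition singletons [set: T].
Proof.
apply/and3P; split.
- by apply/eqP/setP=> v; rewrite inE; apply/bigcupP; exists [set v];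
    rewrite ?set11 ?set1_singletons.
- apply/trivIsetP=> _ _ /imsetP[u _ ->] /imsetP[v _ ->] neq_uv.
  by rewrite disjoints1 inE; apply: contra neq_uv => /eqP ->.
- by apply/imsetP=> -[v _ /setP/(_ v)]; rewrite !inE eqxx.
Qed.

(** Blocks are nonempty, so the sum of their cardinals, which is [#|T|],
    bounds the number of blocks, with equality exactly when every block has
    one element. *)
Lemma card_partition_leqif pi : partition pi [set: T] ->
  #|pi| <= #|T| ?= iff [forall A in pi, #|A| == 1].
Proof.
move=> part_pi; have [_ _ pi0] := and3P part_pi.
have -> : [forall A in pi, #|A| == 1] = [forall A in pi, 1 == #|A|].
  by apply: eq_forallb => A; rewrite [1 == _]eq_sym.
rewrite -sum1_card -[#|T|]cardsT (card_partition part_pi).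
apply: leqif_sum => A piA; split=> //.
by rewrite card_gt0; apply: contraNneq pi0 => <-.
Qed.

Lemma partition_card_max pi :
  partition pi [set: T] -> #|pi| = #|T| -> pi = singletons.
Proof.
move=> part_pi card_pi; apply/eqP.
have /forall_inP pi1 : [forall A in pi, #|A| == 1].
  by rewrite -(card_partition_leqif part_pi).2 card_pi.
rewrite eqEcard card_singletons card_pi leqnn andbT.
apply/subsetP=> A /pi1/cards1P[v ->]; exact: set1_singletons.
Qed.

End SingletonPartition.

(** * Singleton classes in ic-partitions *)

Section Graph.

Variable G : sgraph.
Implicit Types u v w x y : G.

Lemma independent1 v : independent [set v].
Proof.
by apply/forall_inP=> _ /set1P->; apply/forall_inP=> _ /set1P->; rewrite adj_irrefl.
Qed.

Lemma independent2 u v : independent [set u; v] = ~~ adj u v.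
Proof.
apply/idP/idP => [/forall_inP/(_ u (set21 _ _))/forall_inP-> //|nuv].
  exact: set22.
apply/forall_inP=> a /set2P[]->; apply/forall_inP=> b /set2P[]->;
  by rewrite ?adj_irrefl // adj_sym.
Qed.

Lemma dominating1P v :
  reflect (forall w, w != v -> adj w v) (dominating [set v]).
Proof.
apply: (iffP forallP) => dom_v w.
  move/negPf=> neq_wv; have := dom_v w; rewrite inE neq_wv /=.
  by case/exists_inP=> _ /set1P->.
rewrite inE; have [//|/dom_v adj_wv] := eqVneq w v.
by apply/exists_inP; exists v; rewrite ?set11.
Qed.

Lemma dominating2P u v :
  reflect (forall w, w != u -> w != v -> adj w u || adj w v)
          (dominating [set u; v]).
Proof.
apply: (iffP forallP) => dom_uv w.
  move=> /negPf neq_wu /negPf neq_wv; have := dom_uv w.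
  rewrite !inE neq_wu neq_wv /=.
  by case/exists_inP=> _ /set2P[]-> ->; rewrite ?orbT.
rewrite !inE; have [//|/dom_uv adj_w] := eqVneq w u.
have [//|/adj_w adj_w'] := eqVneq w v; apply/exists_inP.
by case/orP: adj_w'; [exists u | exists v]; rewrite ?set21 ?set22.
Qed.

(** Two distinct nonadjacent vertices do not dominate each other, so the
    requirement that neither singleton be an independent dominating set holds
    of itself. *)
Lemma independent_coalition1 u v : u != v ->
  independent_coalition [set u] [set v] = ~~ adj u v && dominating [set u; v].
Proof.
move=> neq_uv; rewrite /independent_coalition /independent_dominating.
rewrite disjoints1 inE neq_uv !independent1 independent2 /=.
case: (boolP (adj u v)) => [|nadj_uv]; first by rewrite !andbF.
have -> : dominating [set u] = false.
  apply/dominating1P=> /(_ v); rewrite eq_sym adj_sym => /(_ neq_uv).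
  exact/negP.
suff -> : dominating [set v] = false by [].
by apply/dominating1P=> /(_ u neq_uv); apply/negP.
Qed.

Definition coalition_partner v u :=
  [&& u != v, ~~ adj v u & dominating [set v; u]].

Lemma ic_partition_singletonsP :
  reflect (forall v, dominating [set v] \/ exists u, coalition_partner v u)
          (ic_partition (singletons G)).
Proof.
rewrite /ic_partition partition_singletons /=.
apply: (iffP forall_inP) => [ic v | ic _ /imsetP[v _ ->]].
  have /orP[/andP[_ ->]|/andP[_]] := ic _ (set1_singletons v); first by left.
  case/exists_inP=> _ /imsetP[u _ ->] /andP[neq_uv].
  have neq : u != v by apply: contra neq_uv => /eqP->.
  rewrite independent_coalition1 1?eq_sym // => coal_vu.
  by right; exists u; apply/andP.
rewrite cards1 /=; have [//|ndom_v] := boolP (dominating [set v]).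
rewrite /independent_dominating independent1 ndom_v /=.
case: (ic v) => [dom_v|[u /andP[neq_uv coal_vu]]].
  by rewrite dom_v in ndom_v.
apply/exists_inP; exists [set u]; first exact: set1_singletons.
rewrite independent_coalition1 1?eq_sym // coal_vu andbT.
by apply: contra neq_uv => /eqP/set1_inj->.
Qed.

Lemma IC_is_order :
  IC_is G (order_of G) <-> ic_partition (singletons G).
Proof.
split=> [[[pi0 ic_pi0] IC_n] | ic1].
  have [|pi ic_pi IC_pi] :=
    eq_bigmax_cond (fun pi : {set {set G}} => #|pi|) (A := @ic_partition G).
    by apply/card_gt0P; exists pi0.
  have /andP[part_pi _] := ic_pi.
  by rewrite -(partition_card_max part_pi) // -IC_pi.
split; first by exists (singletons G).
apply/eqP; rewrite eqn_leq; apply/andP; split.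
  apply/bigmax_leqP=> pi /andP[/card_partition_leqif-[le_pi _] _]; exact: le_pi.
by rewrite /order_of -card_singletons; apply: leq_bigmax_cond.
Qed.

(** * Pendant vertices *)

Lemma min_degree_leq x : min_degree G <= degree x.
Proof.
rewrite /min_degree; elim: (index_enum _) (mem_index_enum x) => //= z s IHs.
rewrite inE big_cons => /predU1P[<-|/IHs]; first exact: geq_minl.
exact/leq_trans/geq_minr.
Qed.

Lemma pendantP x : reflect (exists y, forall z, adj x z = (z == y)) (pendant x).
Proof.
apply: (iffP cards1P) => -[y E]; exists y.
  by move=> z; have /setP/(_ z) := E; rewrite !inE.
by apply/setP=> z; rewrite !inE E.
Qed.

Lemma support_ofP x y : reflect (forall z, adj x z = (z == y)) (support_of x y).
Proof.
apply: (iffP andP) => [[/pendantP[y' E]]|E]; first by rewrite E => /eqP->.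
by split; [apply/pendantP; exists y | rewrite E].
Qed.

(** The least degree is attained by some vertex unless it is the initial value
    [order_of G] of the iterated minimum.  If that value is 1, the graph has a
    vertex, and its degree lies between the minimum degree and the order, which
    are both 1. *)
Lemma exists_support : min_degree G = 1 -> exists x y, support_of x y.
Proof.
move=> delta1.
suff [x deg_x] : exists x, degree x = 1.
  have /pendantP[y Exy] : pendant x by rewrite /pendant deg_x.
  by exists x, y; apply/support_ofP.
have : order_of G = min_degree G \/ exists x, degree x = min_degree G.
  rewrite /min_degree; elim/big_rec: _ => [|x m _ IH]; first by left.
  by rewrite /minn; case: ifP => _; [right; exists x | exact: IH].
rewrite delta1; case=> // order1.
have [x _] : exists x, x \in G by apply/card_gt0P; rewrite [#|_|]order1.
exists x; apply/eqP; rewrite eqn_leq -{2}delta1 min_degree_leq andbT.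
by rewrite -order1 max_card.
Qed.

Lemma cliqueP (A : {set G}) :
  reflect {in A &, forall u v, u != v -> adj u v} (clique A).
Proof.
apply: (iffP forall_inP) => [cl u v /cl/forall_inP cl_u Av | cl u Au].
  exact/implyP/cl_u.
by apply/forall_inP=> v Av; apply/implyP/cl.
Qed.

(** * Graphs with a given pendant vertex *)

Section Support.

Variables x y : G.
Hypothesis sup_xy : support_of x y.

Let adjx z : adj x z = (z == y).
Proof. exact: (support_ofP _ _ sup_xy). Qed.

Let neq_yx : y != x.
Proof. by apply/eqP=> E; have := adjx x; rewrite adj_irrefl E eqxx. Qed.

(** Of two distinct nonadjacent vertices [u] and [v] outside [x] and [y], the
    first must have partner [y], since [u] and [x] do not dominate [v].  So [u]
    is not adjacent to [y], and [v], dominated by [u] and [y], is.  The roles of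
    [u] and [v] can be exchanged, whence the contradiction. *)
Lemma clique_of_ic_singletons :
  ic_partition (singletons G) -> clique ([set: G] :\: [set x; y]).
Proof.
move=> /ic_partition_singletonsP ic.
have partner_y u v : u != x -> u != y -> v != x -> v != y -> u != v ->
    ~~ adj u v -> ~~ adj u y && adj v y.
  move=> neq_ux neq_uy neq_vx neq_vy neq_uv nadj_uv.
  case: (ic u) => [/dominating1P dom_u|[p /and3P[neq_pu nadj_up]]].
    by move: (dom_u v); rewrite eq_sym adj_sym (negPf nadj_uv) => /(_ neq_uv).
  move/dominating2P => dom_up.
  (* The only neighbor of x is y, so neither u nor x would dominate v. *)
  have [eq_px|neq_px] := eqVneq p x.
    have := dom_up v; rewrite eq_sym neq_uv eq_px neq_vx.
    rewrite adj_sym (negPf nadj_uv) adj_sym adjx (negPf neq_vy).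
    by move=> /(_ isT isT).
  (* Some neighbor of x is u or p; as it can only be y, this is p. *)
  have := dom_up x; rewrite !adjx eq_sym neq_ux eq_sym neq_px (negPf neq_uy).
  move=> /(_ isT isT)/eqP eq_py; rewrite eq_py in nadj_up dom_up *.
  rewrite nadj_up /=; have := dom_up v.
  by rewrite eq_sym neq_uv neq_vy adj_sym (negPf nadj_uv); apply.
apply/cliqueP=> u v; rewrite !inE !negb_or !andbT.
move=> /andP[neq_ux neq_uy] /andP[neq_vx neq_vy] neq_uv.
apply: contraT => nadj_uv.
have /andP[nadj_uy _] := partner_y u v neq_ux neq_uy neq_vx neq_vy neq_uv nadj_uv.
have := partner_y v u neq_vx neq_vy neq_ux neq_uy.
by rewrite eq_sym adj_sym (negPf nadj_uy) andbF; apply.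
Qed.

(** A vertex [u] of the clique dominates everything except possibly [x] and
    [y], and [x], [y] are adjacent, so [u] together with [x] or with [y] is
    dominating: [x] and [u] are partners, and so are [y] and any clique vertex
    not adjacent to it.  A third vertex is needed for [x] to have a partner. *)
Lemma ic_singletons_of_clique :
  2 < order_of G -> clique ([set: G] :\: [set x; y]) ->
  ic_partition (singletons G).
Proof.
move=> order_gt2 /cliqueP cl.
have adj_cl u v : u != x -> u != y -> v != x -> v != y -> u != v -> adj u v.
  move=> neq_ux neq_uy neq_vx neq_vy; apply: cl; rewrite !inE negb_or andbT.
    exact/andP.
  exact/andP.
have partner_x u : u != x -> u != y -> coalition_partner x u.
  move=> neq_ux neq_uy; rewrite /coalition_partner neq_ux adjx neq_uy /=.
  apply/dominating2P=> w neq_wx neq_wu; rewrite adj_sym adjx.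
  by have [//|neq_wy /=] := eqVneq w y; apply: adj_cl.
have partnerC u v : coalition_partner u v -> coalition_partner v u.
  by rewrite /coalition_partner eq_sym adj_sym setUC.
apply/ic_partition_singletonsP=> v.
have [->|neq_vx] := eqVneq v x.
  have [u] : exists u, u \in ~: [set x; y].
    apply/card_gt0P; rewrite -(ltn_add2l #|[set x; y]|) cardsC addn0.
    by rewrite cards2 eq_sym neq_yx.
  rewrite !inE negb_or => /andP[neq_ux neq_uy].
  by right; exists u; apply: partner_x.
have [->|neq_vy] := eqVneq v y; last by right; exists x; apply/partnerC/partner_x.
have [dom_y|/negP ndom_y] := boolP (dominating [set y]); [by left | right].
have [w /andP[neq_wy nadj_wy]|no_w] := pickP [pred w | (w != y) && ~~ adj w y].
  have neq_wx : w != x by apply: contraNneq nadj_wy => ->; rewrite adjx.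
  exists w; rewrite /coalition_partner neq_wy adj_sym nadj_wy /=.
  apply/dominating2P=> z neq_zy neq_zw.
  have [->|neq_zx] := eqVneq z x; first by rewrite adjx eqxx.
  by rewrite (adj_cl z w) ?orbT.
case: ndom_y; apply/dominating1P=> w neq_wy; have /negbT := no_w w.
by rewrite /= neq_wy negbK.
Qed.

Lemma K2_of_order2 : order_of G = 2 -> isomorphic G 'K_2.
Proof.
move=> order2.
have xy z : z = x \/ z = y.
  have : z \in [set x; y].
    suff /eqP-> : [set x; y] == setT by [].
    by rewrite eqEcard subsetT cardsT -/(order_of G) order2 cards2 eq_sym neq_yx.
  by case/set2P; [left | right].
have neq_xy := neq_yx; rewrite eq_sym in neq_xy.
exists (fun z => if z == x then ord0 else ord_max : 'K_2).
  exists (fun i : 'K_2 => if i == ord0 then x else y) => [z|i].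
    by have [->|->] := xy z; rewrite ?eqxx // (negPf neq_yx).
  by case: i => -[|[|//]] ? /=; rewrite ?eqxx ?(negPf neq_yx); apply: val_inj.
move=> u v; have [->|->] := xy u; have [->|->] := xy v;
  by rewrite ?eqxx ?(negPf neq_yx) ?adj_irrefl // 1?[adj y x]adj_sym adjx eqxx.
Qed.

End Support.

Lemma ic_singletons_of_K2 :
  isomorphic G 'K_2 -> ic_partition (singletons G).
Proof.
case=> f /bij_inj f_inj adj_f; apply/ic_partition_singletonsP=> v; left.
by apply/dominating1P=> w neq_wv; rewrite -adj_f; apply: contra_neq neq_wv => /f_inj.
Qed.

End Graph.

(** * Graphs of minimum degree 1 with all classes singletons *)

Theorem theorem5p5 (G : sgraph) (n : nat) (order_G : order_of G = n)
    (delta_G : min_degree G = 1) :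
  IC_is G n <-> isomorphic G 'K_2 \/ in_F G.
Proof.
rewrite -order_G; apply: (iff_trans (IC_is_order G)); split=> [ic | [|/and3P[order_gt2 _]]].
- have [x [y sup_xy]] := exists_support delta_G.
  have [order_gt2|order_le2] := ltnP 2 (order_of G).
    right; rewrite /in_F order_gt2 delta_G eqxx /=.
    apply/existsP; exists x; apply/existsP; exists y.
    by rewrite sup_xy clique_of_ic_singletons.
  left; apply: (K2_of_order2 sup_xy); apply/eqP; rewrite eqn_leq order_le2.
  have neq_xy : x != y.
    apply: contraTneq sup_xy => ->; rewrite /support_of adj_irrefl.
    by rewrite andbF.
  have := max_card [set x; y]; by rewrite cards2 neq_xy.
- exact: ic_singletons_of_K2.
case/existsP=> x /existsP[y /andP[sup_xy cl]].
exact: (ic_singletons_of_clique sup_xy).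
Qed.
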